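(* Let $m$ be an integer such that $q=2m-3$ and $r=q+6=2m+3$ are both prime powers, and let $n=m^2$. Let $\chi$ denote the quadratic character on any finite field: $\chi(x)=1$ if $x$ is a nonzero square, $\chi(x)=-1$ if $x$ is a nonsquare, and $\chi(0)=0$. In the group $G=(GF(q),+)\oplus(GF(r),+)$, let $N=\{(0,0)\}$ and $$P=\{(x,y): \chi(x)\chi(y)=1\}\cup\{(0,y): y\neq 0\}.$$ Then $D=P-N$ is a $(4n-9,2n-1,n-1)$ signed difference set in $G$.
   Context: Let $G$ be a finite group of order $v$ and $\mathbb{Z}[G]$ its integral group ring; a subset $S\subseteq G$ is identified with $\sum_{g\in S} g\in\mathbb{Z}[G]$. A $(v,k,\lambda)$ signed difference set in $G$ is an element $D=\sum_{g\in G}s_g g$ with all $s_g\in\{-1,0,1\}$ such that, with $P=\{g:s_g=1\}$, $N=\{g:s_g=-1\}$ and $k=\lvert P\rvert+\lvert N\rvert$, one has $DD^{(-1)}=(k-\lambda)\cdot 1_G+\lambda\sum_{g\in G}g$, where $D^{(-1)}=\sum_g s_g g^{-1}$. *)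

(* Defs.v *)
From HB Require Import structures.
From mathcomp Require Import all_boot all_order all_algebra.
From mathcomp Require Import all_fingroup all_solvable all_field.

Set Implicit Arguments.
Unset Strict Implicit.
Unset Printing Implicit Defensive.

Import GRing.Theory.

Local Open Scope ring_scope.

(* The additive group of Z[G] is {ffun gT -> int}, D g being the coefficient
   of g.  The product [*] that the library puts on {ffun gT -> int} is
   pointwise; the product of the group ring is the convolution [gr_mul]. *)
Definition group_ring (gT : finGroupType) := {ffun gT -> int}.

Section GroupRing.
Variable gT : finGroupType.
Implicit Types (D E : group_ring gT) (S : {set gT}).

Definition gr_mul D E : group_ring gT :=
  [ffun g : gT => \sum_(h : gT) D h * E (h^-1 * g)%g].

Definition gr_inv D : group_ring gT := [ffun g : gT => D (g^-1)%g].

Definition gr_set S : group_ring gT := [ffun g : gT => (g \in S)%:R].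

Definition gr_one : group_ring gT := gr_set [set 1%g].

Definition gr_scale (a : int) D : group_ring gT := [ffun g : gT => a * D g].

Definition gr_pos D : {set gT} := [set g | D g == 1].
Definition gr_neg D : {set gT} := [set g | D g == -1].

(* The parameters are integers, so that expressions such as 4n - 9 are not
   truncated subtractions. *)
Definition signed_difference_set (v k lambda : int) D : Prop :=
  [/\ #|gT|%:Z = v,
      forall g : gT, D g \in [:: -1; 0; 1],
      (#|gr_pos D| + #|gr_neg D|)%N%:Z = k
    & gr_mul D (gr_inv D) =
      (gr_scale (k - lambda) gr_one + gr_scale lambda (gr_set [set: gT])
        : {ffun gT -> int})].

End GroupRing.

Definition prime_power (q : nat) : Prop :=
  exists p e : nat, [/\ prime p, (0 < e)%N & q = (p ^ e)%N].

Definition quad_char (F : finFieldType) (x : F) : int :=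
  if x == 0 then 0 else if [exists y : F, x == y ^+ 2] then 1 else -1.

Section Construction.
Variables F K : finFieldType.

(* The finGroupType that the library infers on F * K is the product of the
   additive groups of F and K, as the next three facts confirm. *)
Definition add_group : finGroupType := (F * K)%type.

Fact add_groupM (x y : add_group) : (x * y)%g = (x.1 + y.1, x.2 + y.2).
Proof. by []. Qed.

Fact add_groupV (x : add_group) : (x^-1)%g = (- x.1, - x.2).
Proof. by []. Qed.

Fact add_group1 : (1%g : add_group) = (0, 0).
Proof. by []. Qed.

Definition sdsP : {set add_group} :=
  [set z : add_group | quad_char z.1 * quad_char z.2 == 1]
    :|: [set z : add_group | (z.1 == 0) && (z.2 != 0)].

Definition sdsN : {set add_group} := [set (0, 0)].

Definition sds : group_ring add_group :=
  (gr_set sdsP : {ffun add_group -> int}) - gr_set sdsN.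

End Construction.

(* Main.v *)
Require Import Defs.
From mathcomp Require Import all_boot all_order all_algebra.
From mathcomp Require Import all_fingroup all_solvable all_field.
From mathcomp Require Import ring zify.

Import Order.TTheory GRing.Theory Num.Theory.

Local Open Scope ring_scope.

(** Let [delta] be the indicator of 0.  Twice the coefficient of [D] at [(x, y)]
    is [chi x * chi y + (1 + delta x) - (1 + 3 * delta x) * delta y], so the
    autocorrelation of [D] is a sum of nine products of a correlation on [F] and
    a correlation on [K], all explicit because
    [\sum_x chi x * chi (x - a) = q * delta a - 1].  The only terms that are not
    combinations of indicators add up to
    [-3 * chi a * chi b * (1 + chi (-1) * chi (-1))], and they vanish because
    [r = q + 6] makes -1 a square in exactly one of the two fields. *)

(** * Quadratic character of a finite field of odd order *)

Section QuadraticCharacter.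

Variable F : finFieldType.

Local Notation chi := (@quad_char F).

Lemma quad_char0 : chi 0 = 0.
Proof. by rewrite /quad_char eqxx. Qed.

Lemma quad_char_cases (x : F) : x != 0 ->
  (exists2 y, x = y ^+ 2 & chi x = 1) \/ chi x = -1.
Proof.
move=> x0; rewrite /quad_char (negPf x0).
by case: existsP => [[y /eqP xy]|]; [left; exists y | right].
Qed.

Lemma quad_char_sqrM (x y : F) : x != 0 -> chi (x ^+ 2 * y) = chi y.
Proof.
move=> x0; rewrite /quad_char mulf_eq0 expf_eq0 /= (negPf x0) /=.
case: ifP => // _; congr (if _ then _ else _).
apply/existsP/existsP => -[z /eqP yz].
  exists (z / x); apply/eqP; rewrite exprMn -yz exprVn mulrAC mulfV ?mul1r //.
  by rewrite expf_neq0.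
by exists (x * z); rewrite yz exprMn.
Qed.

Lemma quad_char1 : chi 1 = 1.
Proof.
rewrite /quad_char oner_eq0; case: existsP => // -[].
by exists 1; rewrite expr1n.
Qed.

Lemma quad_char_sqr (x : F) : x != 0 -> chi (x ^+ 2) = 1.
Proof. by move=> x0; rewrite -[x ^+ 2]mulr1 quad_char_sqrM ?quad_char1. Qed.

Lemma quad_char_mulself (x : F) : chi x * chi x = (x != 0)%:R.
Proof.
have [->|x0] := eqVneq x 0; first by rewrite quad_char0.
by case: (quad_char_cases _ x0) => [[? _]|] ->.
Qed.

Hypothesis F_odd : odd #|F|.

Lemma odd_card_two_neq0 : (2 : F) != 0.
Proof.
apply/negP => /eqP two0.
(* If 2 = 0, the order of 1 in the additive group divides 2 as well as the odd number [#|F|], so 1 =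
   0. *)
have : (order (1%R : F) %| gcdn 2 #|F|)%N.
  rewrite dvdn_gcd -cardsT order_dvdG ?inE // andbT order_dvdn.
  by apply/eqP; exact: two0.
have /eqP -> : coprime 2 #|F| by rewrite coprime2n.
by rewrite dvdn1 order_eq1 => /eqP /eqP; rewrite oner_eq0.
Qed.

Lemma sum_sqrt_quad_char (x : F) :
  \sum_(y : F) (y ^+ 2 == x)%:R = 1 + chi x.
Proof.
have [->|x0] := eqVneq x 0.
  rewrite quad_char0 (bigD1 0) //= expr0n eqxx big1 // => y y0.
  by rewrite expf_eq0 (negPf y0).
case: (quad_char_cases _ x0) => [[z xz ->]|chix].
  have z0 : z != 0 by apply: contraNneq x0 => z0; rewrite xz z0 expr0n.
  have zN : - z != z.
    rewrite -subr_eq0 -opprD oppr_eq0 -mulr2n -mulr_natl.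
    by rewrite mulf_neq0 ?odd_card_two_neq0.
  rewrite (bigD1 z) //= (bigD1 (- z)) //= xz sqrrN eqxx big1 //.
  move=> y /andP[yz yNz].
  by rewrite eqf_sqr (negPf yz) (negPf yNz).
rewrite chix big1 // => y _; case: eqP => // yx.
have y0 : y != 0 by apply: contraNneq x0 => y0; rewrite -yx y0 expr0n.
by move: chix; rewrite -yx quad_char_sqr.
Qed.

(** Count the pairs [(x, y)] with [y ^+ 2 = x] in two ways: each [y] lies in one pair, each [x] in
    [1 + chi x] pairs. *)
Lemma sum_quad_char : \sum_(x : F) chi x = 0.
Proof.
have : \sum_(x : F) (1 + chi x) = #|F|%:Z.
  under eq_bigr => x _ do rewrite -sum_sqrt_quad_char.
  rewrite exchange_big /= -natz -sumr_const; apply: eq_bigr => y _.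
  rewrite (bigD1 (y ^+ 2)) //= eqxx big1 // => x.
  by rewrite eq_sym => /negPf ->.
by rewrite big_split sumr_const /= natz => /(canRL (addKr _)) ->; rewrite addNr.
Qed.

(* The map [x |-> a * x] sends squares to nonsquares when [a] is a nonsquare, so
   every term of [\sum_x (chi (a * x) + chi x) = 0] is nonpositive. *)
Lemma quad_charM : {morph chi : x y / x * y}.
Proof.
move=> a x; have [->|a0] := eqVneq a 0; first by rewrite mul0r quad_char0 mul0r.
case: (quad_char_cases _ a0) => [[b ab ->]|chia].
  have b0 : b != 0 by apply: contraNneq a0 => b0; rewrite ab b0 expr0n.
  by rewrite mul1r ab quad_char_sqrM.
have le0 (y : F) : 0 <= - (chi (a * y) + chi y).
  have [->|y0] := eqVneq y 0; first by rewrite mulr0 quad_char0.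
  case: (quad_char_cases _ y0) => [[z yz ->]|->].
    have z0 : z != 0 by apply: contraNneq y0 => z0; rewrite yz z0 expr0n.
    by rewrite yz mulrC quad_char_sqrM // chia.
  have ay0 : a * y != 0 by rewrite mulf_neq0.
  by case: (quad_char_cases _ ay0) => [[? _]|] ->.
have sum0 : \sum_(y : F) - (chi (a * y) + chi y) = 0.
  rewrite sumrN big_split /= sum_quad_char addr0.
  rewrite -(reindex_inj (mulfI a0) (P := xpredT) (F := chi)) sum_quad_char.
  exact: oppr0.
have /(_ x isT) := psumr_eq0P (fun y _ => le0 y) sum0.
by rewrite chia; lia.
Qed.

(** For nonzero [a] and [x], [x * (x - a)] is the square [x ^+ 2] times [1 - a / x], and [1 - a / x]
    takes every value except 1 once; the full sum of [chi] is 0 and [chi 1 = 1]. *)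
Lemma quad_char_corr (a : F) :
  \sum_(x : F) chi x * chi (x - a) = #|F|%:Z * (a == 0)%:R - 1.
Proof.
have [->|a0] := eqVneq a 0.
  under eq_bigr => x _ do rewrite subr0 quad_char_mulself.
  rewrite (bigD1 0) //= eqxx add0r mulr1.
  transitivity (\sum_(x in predC1 (0 : F)) (1 : int)).
    by apply: eq_bigr => x ->.
  by rewrite sumr_const cardC1 natz predn_int ?(ltnW (finNzRing_gt1 F)).
rewrite mulr0n mulr0 add0r (bigD1 0) //= quad_char0 mul0r add0r.
transitivity (\sum_(x : F | x != 0) chi (1 - a / x)).
  apply: eq_bigr => x x0; rewrite -quad_charM -[RHS](quad_char_sqrM x) //.
  by congr chi; field.
have := sum_quad_char; rewrite (bigD1 1) //= quad_char1.
rewrite (reindex (fun x => 1 - a / x)) /=; last first.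
  exists (fun u => a / (1 - u)) => u; rewrite inE => u1.
    (* Since [0^-1 = 0], the map sends 0 to the excluded value 1. *)
    have u0 : u != 0.
      by apply: contraNneq u1 => ->; rewrite invr0 mulr0 subr0.
    by field; rewrite u0 opprB addrC subrK.
  by field; rewrite a0 subr_eq0 eq_sym u1.
move=> sum0; apply: (addrI 1); rewrite subrr -[RHS]sum0.
congr (_ + _); apply: eq_bigl => x.
rewrite -[X in _ = ~~ X]subr_eq0 addrAC subrr add0r oppr_eq0.
by rewrite mulf_eq0 (negPf a0) invr_eq0.
Qed.

(** Euler's criterion at -1. If [-1 = y ^+ 2], then [(-1) ^+ k = y ^+ k * y ^+ k = 1]. Conversely,
    some [x] has [x ^+ k = -1], which exhibits -1 as a square when [k] is even. *)
Lemma quad_charN1 : chi (-1) = (-1) ^+ (#|F|./2).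
Proof.
set k := #|F|./2.
have cardF : #|F| = (k + k).+1 by rewrite -[LHS]odd_double_half F_odd addnn.
have N1_neq0 : (-1 : F) != 0 by rewrite oppr_eq0 oner_eq0.
have N1_neq1 : (-1 : F) != 1.
  by rewrite -subr_eq0 -opprD oppr_eq0 odd_card_two_neq0.
have expF (x : F) : x != 0 -> x ^+ k * x ^+ k = 1.
  move=> x0; apply: (mulfI x0).
  by rewrite -exprD -exprS -cardF expf_card mulr1.
rewrite -signr_odd; case: (quad_char_cases _ N1_neq0) => [[y y2 chi1]|chiN1].
  have y0 : y != 0 by apply: contraNneq N1_neq0 => y0; rewrite y2 y0 expr0n.
  have := expF _ y0; rewrite -exprMn -expr2 -y2 -(signr_odd F k) chi1.
  by case: odd => // /eqP; rewrite expr1 (negPf N1_neq1).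
rewrite chiN1; case: (boolP (odd k)) => // k_even.
have k_gt0 : (0 < k)%N by have := finNzRing_gt1 F; rewrite cardF; case: (k).
(* Otherwise all [2k] nonzero elements would be roots of ['X^k - 1], which has at most [k]. *)
have /existsP[x /andP[x0 xk]] : [exists x : F, (x != 0) && (x ^+ k != 1)].
  rewrite -[X in is_true X]negbK negb_exists; apply/negP => /forallP all1.
  have XkB1_neq0 : 'X^k - 1%:P != 0 :> {poly F}.
    by rewrite -size_poly_gt0 size_XnsubC.
  have := max_poly_roots XkB1_neq0 _ (enum_uniq (predC1 (0 : F))).
  rewrite size_XnsubC // -cardE cardC1 cardF /= => lek.
  suff /lek : all (root ('X^k - 1%:P)) (enum (predC1 (0 : F))) by lia.
  apply/allP => x; rewrite mem_enum inE => x0.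
  rewrite rootE !hornerE subr_eq0.
  by have := all1 x; rewrite x0 negbK.
have xkN1 : x ^+ k = -1.
  by apply/eqP; have /eqP := expF _ x0; rewrite -expr2 sqrf_eq1 (negPf xk).
move: chiN1; rewrite -xkN1 -[k]odd_double_half (negPf k_even) -muln2 exprM.
by rewrite quad_char_sqr ?expf_neq0.
Qed.

(** * Correlations of combinations of [chi], 1 and the indicator of 0 *)

Lemma sum_quad_char_shift (a : F) : \sum_(x : F) chi (x - a) = 0.
Proof.
by rewrite -(reindex_inj (addIr (- a)) (P := xpredT) (F := chi)) sum_quad_char.
Qed.

Lemma sum_mul_eq (f : F -> int) (a : F) :
  \sum_(x : F) f x * (x == a)%:R = f a.
Proof.
rewrite (bigD1 a) //= eqxx mulr1 big1 ?addr0 // => x /negPf ->.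
by rewrite mulr0.
Qed.

Lemma sum_indicator (a : F) : \sum_(x : F) (x == a)%:R = 1 :> int.
Proof.
rewrite -[RHS](sum_mul_eq (fun=> 1) a).
by apply: eq_bigr => x _; rewrite mul1r.
Qed.

Definition chi_comb (c : int * int * int) (x : F) : int :=
  c.1.1 * chi x + c.1.2 + c.2 * (x == 0)%:R.

(** [chi] against a constant sums to 0, and against an indicator gives [chi a] or [chi (- a)]; the
    latter is the source of [chi (-1)]. *)
Lemma chi_comb_corr (c d : int * int * int) (a : F) :
  \sum_(x : F) chi_comb c x * chi_comb d (x - a) =
    c.1.1 * d.1.1 * (#|F|%:Z * (a == 0)%:R - 1)
    + (c.1.2 * d.1.2 * #|F|%:Z + c.1.2 * d.2 + c.2 * d.1.2)
    + c.2 * d.2 * (a == 0)%:R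
    + (c.1.1 * d.2 + c.2 * d.1.1 * chi (-1)) * chi a.
Proof.
rewrite /chi_comb; case: c d => [[c1 c2] c3] [[d1 d2] d3] /=.
transitivity (\sum_(x : F)
   (c1 * d1 * (chi x * chi (x - a)) + c1 * d2 * chi x + c2 * d1 * chi (x - a)
    + c2 * d2 * 1 + c2 * d3 * (x == a)%:R + c3 * d2 * (x == 0)%:R
    + c1 * d3 * (chi x * (x == a)%:R)
    + c3 * d1 * (chi (x - a) * (x == 0)%:R)
    + c3 * d3 * ((x == a)%:R * (x == 0)%:R))).
  by apply: eq_bigr => x _; rewrite subr_eq0; ring.
rewrite !big_split /= -!mulr_sumr !sum_mul_eq quad_char_corr sum_quad_char.
rewrite sum_quad_char_shift !sum_indicator sumr_const natz sub0r.
rewrite -[- a]mulN1r quad_charM [0 == a]eq_sym; ring.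
Qed.

End QuadraticCharacter.

(** Both sides are the sum of the squared coefficients, so [k] can be read off the product at the
    identity. *)
Lemma card_pos_neg (gT : finGroupType) (D : group_ring gT) :
  (forall g, D g \in [:: -1; 0; 1]) ->
  (#|gr_pos D| + #|gr_neg D|)%N%:Z = gr_mul D (gr_inv D) 1%g.
Proof.
move=> rangeD; rewrite ffunE -natz natrD -!sum1_card !natr_sum.
rewrite !(big_mkcond (fun g => g \in _)) /=.
rewrite -big_split; apply: eq_bigr => g _.
rewrite ffunE mulg1 invgK !inE.
by have := rangeD g; rewrite !inE => /or3P[] /eqP ->.
Qed.

Lemma sum_prod_mul (S T : finType) (f : S -> int) (g : T -> int) :
  \sum_(z : S * T) f z.1 * g z.2 = (\sum_x f x) * (\sum_y g y).
Proof. by rewrite big_distrlr /= pair_bigA. Qed.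

(** * Autocorrelation of [sds] *)

Section Sds.

Variables F K : finFieldType.

Lemma sdsE (z : add_group F K) : 2 * sds F K z =
  chi_comb F (1, 0, 0) z.1 * chi_comb K (1, 0, 0) z.2
  + chi_comb F (0, 1, 1) z.1 * chi_comb K (0, 1, 0) z.2
  - chi_comb F (0, 1, 3) z.1 * chi_comb K (0, 0, 1) z.2.
Proof.
case: z => x y; rewrite !ffunE !inE /chi_comb /= xpair_eqE.
have [->|x0] := eqVneq x 0; have [->|y0] := eqVneq y 0;
  rewrite ?quad_char0 //=.
- by case: (quad_char_cases K y y0) => [[? _]|] ->.
- by case: (quad_char_cases F x x0) => [[? _]|] ->.
by case: (quad_char_cases F x x0) => [[? _]|] ->;
   case: (quad_char_cases K y y0) => [[? _]|] ->.
Qed.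

Lemma sds_range (z : add_group F K) : sds F K z \in [:: -1; 0; 1].
Proof.
case: z => x y; rewrite !ffunE !inE xpair_eqE /=.
have [->|x0] := eqVneq x 0; first by rewrite quad_char0 mul0r; case: (y == 0).
by rewrite orbF; case: (_ == 1).
Qed.

Hypothesis F_odd : odd #|F|.
Hypothesis K_odd : odd #|K|.
Hypothesis FK : #|K| = (#|F| + 6)%N.

(** The halves of the two orders differ by 3, so the two signs are opposite. *)
Lemma quad_charN1_mul : quad_char (-1 : F) * quad_char (-1 : K) = -1.
Proof.
rewrite !quad_charN1 // FK halfD andbF add0n -exprD addnA exprD addnn -mul2n.
by rewrite exprM sqrrN expr1n mul1r.
Qed.

Lemma sds_corr (a : F) (b : K) :
  4 * \sum_(h : add_group F K) sds F K h * sds F K (h.1 - a, h.2 - b) =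
    #|F|%:Z * #|K|%:Z + 5
    + (#|F|%:Z * #|K|%:Z + 9) * (a == 0)%:R * (b == 0)%:R.
Proof.
pose f (i : 'I_3) : int * int * int :=
  (* The three products of [sdsE], with the minus sign of the third moved into its factor on [F]. *)
  [:: (1, 0, 0); (0, 1, 1); (0, -1, -3)]`_i.
pose g (i : 'I_3) : int * int * int :=
  [:: (1, 0, 0); (0, 1, 0); (0, 0, 1)]`_i.
have sds2 z : 2 * sds F K z =
    \sum_(i < 3) chi_comb F (f i) z.1 * chi_comb K (g i) z.2.
  rewrite sdsE !big_ord_recl big_ord0 /= /chi_comb /=; ring.
transitivity (\sum_(i < 3) \sum_(j < 3)
   (\sum_x chi_comb F (f i) x * chi_comb F (f j) (x - a))
   * (\sum_y chi_comb K (g i) y * chi_comb K (g j) (y - b))).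
  under [RHS]eq_bigr => i _ do under eq_bigr => j _ do rewrite -sum_prod_mul.
  under [RHS]eq_bigr => i _ do rewrite exchange_big.
  rewrite [RHS]exchange_big mulr_sumr; apply: eq_bigr => h _ /=.
  transitivity ((2 * sds F K h) * (2 * sds F K (h.1 - a, h.2 - b))).
    by ring.
  rewrite !sds2 big_distrlr; apply: eq_bigr => i _; apply: eq_bigr => j _ /=.
  by ring.
under eq_bigr => i _ do under eq_bigr => j _ do rewrite !chi_comb_corr //.
rewrite !big_ord_recl !big_ord0 /= FK PoszD.
set u := quad_char (-1 : F); set v := quad_char (-1 : K).
set qa := quad_char a; set qb := quad_char b.
have uv0 : - 3 * qa * qb * (1 + u * v) = 0.
  by rewrite quad_charN1_mul subrr mulr0.
(* Adding this zero to the right-hand side leaves a formal polynomial identity in the character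
   values and the indicators. *)
rewrite -[RHS]addr0 -[X in _ = _ + X]uv0.
ring.
Qed.

End Sds.

Theorem theorem7 (m n : int) (q r : nat)
    (hq : q%:Z = 2 * m - 3) (hr : r%:Z = 2 * m + 3)
    (ppq : prime_power q) (ppr : prime_power r)
    (hn : n = m ^+ 2)
    (F K : finFieldType) (cardF : #|F| = q) (cardK : #|K| = r) :
  @signed_difference_set (add_group F K) (4 * n - 9) (2 * n - 1) (n - 1)
    (sds F K).
Proof.
have F_odd : odd #|F| by rewrite cardF; lia.
have K_odd : odd #|K| by rewrite cardK; lia.
have cardFK : #|K| = (#|F| + 6)%N by rewrite cardF cardK; lia.
have qr : #|F|%:Z * #|K|%:Z = 4 * n - 9 by rewrite cardF cardK hq hr hn; ring.
have corr : gr_mul (sds F K) (gr_inv (sds F K)) =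
    (gr_scale (2 * n - 1 - (n - 1)) (gr_one _)
     + gr_scale (n - 1) (gr_set [set: add_group F K])
     : {ffun add_group F K -> int}).
  apply/ffunP => -[a b]; rewrite !ffunE !inE xpair_eqE.
  (* [sds_corr] computes four times the coefficient; with [qr = 4 * n - 9], its constants become
     [qr + 5 = 4 * (n - 1)] and [qr + 9 = 4 * n]. *)
  apply: (@mulfI _ 4) => //.
  transitivity (4 * \sum_(h : add_group F K)
      sds F K h * sds F K (h.1 - a, h.2 - b)).
    congr (4 * _); apply: eq_bigr => -[x y] _.
    rewrite [gr_inv _ _]ffunE; congr (_ * sds F K _).
    by rewrite add_groupV add_groupM add_groupV /= !opprD !opprK.
  by rewrite sds_corr // qr; case: (a == 0); case: (b == 0) => /=; ring.
split=> //; first by rewrite card_prod PoszM qr.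
  exact: sds_range.
rewrite card_pos_neg; last exact: sds_range.
(* At the identity the product is [(k - lambda) + lambda], with [k = 2 * n - 1]. *)
rewrite corr !ffunE !inE eqxx /=; ring.
Qed.
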